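(* Let $A$ be a $C^*$-algebra, $H$ a Hilbert space (not necessarily finite dimensional), $k\in\mathbb{N}$, and $\varphi:A\to\mathcal{B}(H)$ a linear map. Then the following conditions are equivalent: (i) $\varphi$ is $k$-positive; (ii) for every $n\in\mathbb{N}$, every set of vectors $\xi_1,\dots,\xi_n\in H$ such that $\dim\mathrm{span}\{\xi_1,\dots,\xi_n\}\le k$, and every $[a_{ij}]\in M_n(A)^+$, we have $\sum_{i,j=1}^n\langle\xi_i,\varphi(a_{ij})\xi_j\rangle\ge 0$; (iii) for every $p\in\mathrm{Proj}_k(H)$ the map $A\ni a\mapsto p\varphi(a)p\in\mathcal{B}(H)$ is completely positive.
   Context: Inner products are linear in the second variable. $M_n(A)^+$ is the set of positive elements of the $C^*$-algebra of $n\times n$ matrices over $A$. $\mathrm{Proj}_k(H)=\{p\in\mathcal{B}(H):p^*=p=p^2,\ \mathrm{Tr}\,p\le k\}$. A linear map $\varphi:A\to B$ between $C^*$-algebras is $k$-positive if $\varphi_k:M_k(A)\to M_k(B)$, $\varphi_k([a_{ij}])=[\varphi(a_{ij})]$, maps $M_k(A)^+$ into $M_k(B)^+$; it is completely positive if it is $k$-positive for every $k\in\mathbb{N}$. *)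

(* Defs.v *)
From HB Require Import structures.
From mathcomp Require Import all_boot all_order all_algebra.
From mathcomp Require Import complex lra ring.
From mathcomp Require Import all_classical all_reals all_analysis.

Set Implicit Arguments.
Unset Strict Implicit.
Unset Printing Implicit Defensive.

Import Order.TTheory GRing.Theory Num.Theory.
Import numFieldNormedType.Exports.

Local Open Scope classical_set_scope.
Local Open Scope complex_scope.
Local Open Scope ring_scope.

(* Complex *-algebras. No unit is assumed, so these do not build on the ring
   structures of the library. *)
HB.mixin Record isStarAlgebra (R : realType) A & GRing.Lmodule R[i] A := {
  amul : A -> A -> A;
  star : A -> A;
  amulA : associative amul;
  amulDl : left_distributive amul +%R;
  amulDr : right_distributive amul +%R;
  amulZl : forall (c : R[i]) x y, amul (c *: x) y = c *: amul x y;
  amulZr : forall (c : R[i]) x y, amul x (c *: y) = c *: amul x y;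
  starK : involutive star;
  starD : {morph star : x y / x + y};
  starZ : forall (c : R[i]) x, star (c *: x) = conjc c *: star x;
  starM : forall x y, star (amul x y) = amul (star y) (star x)
}.

#[short(type="starAlgType")]
HB.structure Definition StarAlgebra (R : realType) :=
  {A of isStarAlgebra R A & GRing.Lmodule R[i] A}.

HB.mixin Record isCStarNormed (R : realType) A
    & StarAlgebra R A & CompleteNormedModule R[i] A := {
  norm_amul : forall x y : A, `|amul x y| <= `|x| * `|y|;
  norm_cstar : forall x : A, `|amul (star x) x| = `|x| ^+ 2
}.

#[short(type="cstarAlgType")]
HB.structure Definition CStarAlgebra (R : realType) :=
  {A of isCStarNormed R A & StarAlgebra R A & CompleteNormedModule R[i] A}.

HB.mixin Record isHilbert (R : realType) H & CompleteNormedModule R[i] H := {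
  inner : H -> H -> R[i];
  innerDr : forall x y z, inner x (y + z) = inner x y + inner x z;
  innerZr : forall (c : R[i]) x y, inner x (c *: y) = c * inner x y;
  innerC : forall x y, inner y x = conjc (inner x y);
  inner_norm : forall x, inner x x = `|x| ^+ 2
}.

#[short(type="hilbertType")]
HB.structure Definition Hilbert (R : realType) :=
  {H of isHilbert R H & CompleteNormedModule R[i] H}.

Notation "''[' x , y ]" := (inner x y) : ring_scope.

Section StarAlgebraTheory.
Variables (R : realType) (A : starAlgType R).
Implicit Types (x y : A) (c : R[i]).

Lemma amul0r x : amul 0 x = 0.
Proof. by rewrite -{1}(scale0r 0) amulZl scale0r. Qed.

Lemma amulr0 x : amul x 0 = 0.
Proof. by rewrite -{1}(scale0r 0) amulZr scale0r. Qed.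

Lemma amul_suml (I : Type) (r : seq I) (P : pred I) (F : I -> A) x :
  amul (\sum_(i <- r | P i) F i) x = \sum_(i <- r | P i) amul (F i) x.
Proof. by apply: (big_morph (amul^~ x)) => [y z|]; rewrite ?amulDl ?amul0r. Qed.

Lemma amul_sumr (I : Type) (r : seq I) (P : pred I) (F : I -> A) x :
  amul x (\sum_(i <- r | P i) F i) = \sum_(i <- r | P i) amul x (F i).
Proof. by apply: (big_morph (amul x)) => [y z|]; rewrite ?amulDr ?amulr0. Qed.

Lemma star0 : star 0 = 0 :> A.
Proof. by rewrite -{1}(scale0r 0) starZ conjc0 scale0r. Qed.

Lemma star_sum (I : Type) (r : seq I) (P : pred I) (F : I -> A) :
  star (\sum_(i <- r | P i) F i) = \sum_(i <- r | P i) star (F i).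
Proof. by apply: (big_morph (@star R A)) => [y z|]; rewrite ?starD ?star0. Qed.

(* In a C*-algebra the positive elements are those of the form [b^* b]. This
   involves only the *-algebra structure, so the C*-norms of the matrix algebras
   and of the algebra of bounded operators are not needed below. *)
Definition positive : set A := [set a | exists b, a = amul (star b) b].

End StarAlgebraTheory.

(* An alias of ['M[A]_n]: the library's scaling on ['M[A]_n] is by elements of
   the entry type, whereas here the scalars are in [R[i]]. *)
Definition matalg (R : realType) (A : starAlgType R) (n : nat) := 'M[A]_n.

Section MatrixAlgebra.
Variables (R : realType) (A : starAlgType R) (n : nat).

HB.instance Definition _ := GRing.Zmodule.copy (matalg A n) 'M[A]_n.

Implicit Types (X Y Z : matalg A n) (c : R[i]).

Definition mat_scale c X : matalg A n := \matrix_(i, j) (c *: X i j).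
Definition mat_mul X Y : matalg A n :=
  \matrix_(i, j) \sum_l amul (X i l) (Y l j).
Definition mat_star X : matalg A n := \matrix_(i, j) star (X j i).

Let mat_scaleA c d X : mat_scale c (mat_scale d X) = mat_scale (c * d) X.
Proof. by apply/matrixP => i j; rewrite !mxE scalerA. Qed.

Let mat_scale1 : left_id 1 mat_scale.
Proof. by move=> X; apply/matrixP => i j; rewrite !mxE scale1r. Qed.

Let mat_scaleDr : right_distributive mat_scale +%R.
Proof. by move=> c X Y; apply/matrixP => i j; rewrite !mxE scalerDr. Qed.

Let mat_scaleDl X : {morph mat_scale^~ X : c d / c + d}.
Proof. by move=> c d; apply/matrixP => i j; rewrite !mxE scalerDl. Qed.

HB.instance Definition _ := GRing.Zmodule_isLmodule.Build R[i] (matalg A n)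
  mat_scaleA mat_scale1 mat_scaleDr mat_scaleDl.

Let mat_mulA : associative mat_mul.
Proof.
move=> X Y Z; apply/matrixP => i j; rewrite !mxE.
under eq_bigr do rewrite mxE amul_sumr.
rewrite exchange_big; apply: eq_bigr => l _ /=.
by rewrite mxE amul_suml; apply: eq_bigr => m _; rewrite amulA.
Qed.

Let mat_mulDl : left_distributive mat_mul +%R.
Proof.
move=> X Y Z; apply/matrixP => i j; rewrite !mxE -big_split.
by apply: eq_bigr => l _; rewrite mxE amulDl.
Qed.

Let mat_mulDr : right_distributive mat_mul +%R.
Proof.
move=> X Y Z; apply/matrixP => i j; rewrite !mxE -big_split.
by apply: eq_bigr => l _; rewrite mxE amulDr.
Qed.

Let mat_mulZl c X Y : mat_mul (c *: X) Y = c *: mat_mul X Y.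
Proof.
apply/matrixP => i j; rewrite !mxE scaler_sumr.
by apply: eq_bigr => l _; rewrite mxE amulZl.
Qed.

Let mat_mulZr c X Y : mat_mul X (c *: Y) = c *: mat_mul X Y.
Proof.
apply/matrixP => i j; rewrite !mxE scaler_sumr.
by apply: eq_bigr => l _; rewrite mxE amulZr.
Qed.

Let mat_starK : involutive mat_star.
Proof. by move=> X; apply/matrixP => i j; rewrite !mxE starK. Qed.

Let mat_starD : {morph mat_star : X Y / X + Y}.
Proof. by move=> X Y; apply/matrixP => i j; rewrite !mxE starD. Qed.

Let mat_starZ c X : mat_star (c *: X) = conjc c *: mat_star X.
Proof. by apply/matrixP => i j; rewrite !mxE starZ. Qed.

Let mat_starM X Y : mat_star (mat_mul X Y) = mat_mul (mat_star Y) (mat_star X).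
Proof.
apply/matrixP => i j; rewrite !mxE star_sum.
by apply: eq_bigr => l _; rewrite !mxE starM.
Qed.

HB.instance Definition _ := isStarAlgebra.Build R (matalg A n)
  mat_mulA mat_mulDl mat_mulDr mat_mulZl mat_mulZr
  mat_starK mat_starD mat_starZ mat_starM.

End MatrixAlgebra.

Section KPositive.
Variables (R : realType) (A B : starAlgType R).

Definition amplification (phi : A -> B) (k : nat) (X : matalg A k) :
  matalg B k := map_mx phi X.

Definition k_positive (k : nat) (phi : {linear A -> B}) : Prop :=
  amplification phi (k := k) @` @positive R (matalg A k)
    `<=` @positive R (matalg B k).

Definition completely_positive (phi : {linear A -> B}) : Prop :=
  forall k, k_positive k phi.

End KPositive.

Section HilbertTheory.
Variables (R : realType) (H : hilbertType R).
Implicit Types (x y z : H) (c : R[i]).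

Lemma innerDl x y z : '[x + y, z] = '[x, z] + '[y, z].
Proof. by rewrite innerC innerDr rmorphD/= -!innerC. Qed.

Lemma innerZl c x y : '[c *: x, y] = conjc c * '[x, y].
Proof. by rewrite innerC innerZr rmorphM/= -innerC. Qed.

Lemma inner0r x : '[x, 0] = 0.
Proof. by rewrite -(scale0r 0) innerZr mul0r. Qed.

Lemma inner0l x : '[0, x] = 0.
Proof. by rewrite innerC inner0r conjc0. Qed.

Lemma innerNr x y : '[x, - y] = - '[x, y].
Proof. by rewrite -scaleN1r innerZr mulN1r. Qed.

Lemma innerNl x y : '[- x, y] = - '[x, y].
Proof. by rewrite innerC innerNr rmorphN/= -innerC. Qed.

Lemma innerBr x y z : '[x, y - z] = '[x, y] - '[x, z].
Proof. by rewrite innerDr innerNr. Qed.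

Lemma innerBl x y z : '[x - y, z] = '[x, z] - '[y, z].
Proof. by rewrite innerDl innerNl. Qed.

Lemma inner_inj x y : (forall z, '[x, z] = '[y, z]) -> x = y.
Proof.
move=> e; apply/eqP; rewrite -subr_eq0 -normr_eq0 -sqrf_eq0 -inner_norm.
by rewrite innerBl e subrr.
Qed.

Lemma cauchy_schwarz x y : `|'[x, y]| <= `|x| * `|y|.
Proof.
have [->|y0] := eqVneq y 0; first by rewrite inner0r normr0 normr0 mulr0.
have n0 : 0 < `|y| ^+ 2 by rewrite exprn_gt0// normr_gt0.
rewrite -(@ler_pXn2r _ 2)// ?nnegrE ?mulr_ge0// exprMn.
pose z := `|y| ^+ 2 *: x - '[y, x] *: y.
have yz : '[y, z] = 0.
  by rewrite innerBr !innerZr inner_norm mulrC subrr.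
have : 0 <= '[z, z] by rewrite inner_norm exprn_ge0.
rewrite {1}/z innerBl !innerZl yz mulr0 subr0 innerBr !innerZr !inner_norm.
have -> : conjc (`|y| ^+ 2) = `|y| ^+ 2 by rewrite -inner_norm -innerC.
rewrite pmulr_rge0// subr_ge0 [X in X * _]innerC mulrC -sqr_normc => h.
by rewrite mulrC in h.
Qed.

(* [`|x|] lives in [R[i]]; [nr x] is the same number in [R]. *)
Let nr x : R := complex.Re `|x|.

Let nrE x : `|x| = (nr x)%:C.
Proof. by rewrite /nr RRe_real// ger0_real. Qed.

Let nr_ge0 x : 0 <= nr x.
Proof. by have := normr_ge0 x; rewrite nrE ler0c. Qed.

Let nr2 x : nr x ^+ 2 = complex.Re '[x, x].
Proof. by rewrite inner_norm nrE -rmorphXn. Qed.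

Let ReE c : complex.Re c <= complex.Re `|c|.
Proof.
have : `|complex.Re c|%:C <= `|c| := normc_ge_Re c.
rewrite -[X in _ <= X]RRe_real ?ger0_real// lecR; exact/le_trans/ler_norm.
Qed.

Let ReD c d : complex.Re (c + d) = complex.Re c + complex.Re d.
Proof. by case: c d => [? ?] []. Qed.
Let ReN c : complex.Re (- c) = - complex.Re c.
Proof. by case: c. Qed.
Let ReZ (t : R) c : complex.Re (t%:C * c) = t * complex.Re c.
Proof. by case: c => a b /=; rewrite mul0r subr0. Qed.
Let ReJ c : complex.Re (conjc c) = complex.Re c.
Proof. by case: c. Qed.

Let nr2D x y :
  nr (x + y) ^+ 2 = nr x ^+ 2 + 2 * complex.Re '[x, y] + nr y ^+ 2.
Proof.
rewrite !nr2 innerDl !innerDr !ReD [in X in _ + (X + _)]innerC ReJ; ring.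
Qed.

Let cauchy_schwarzR x y : `|complex.Re '[x, y]| <= nr x * nr y.
Proof.
rewrite -lecR (le_trans (normc_ge_Re _))// (le_trans (cauchy_schwarz _ _))//.
by rewrite !nrE -rmorphM.
Qed.

Lemma riesz_representation (f : {linear H -> R[i]^o}) :
  (exists M : R[i], forall x, `|f x| <= M * `|x|) ->
  exists z, forall y, '[z, y] = f y.
Proof.
move=> [M0 fM0].
have [M fM] : exists M, forall x, complex.Re `|f x| <= M * nr x.
  exists (complex.Re M0) => x; have := fM0 x; rewrite nrE lecE => /andP[_].
  by rewrite mulrC ReZ mulrC.
have fD x y : f (x + y) = f x + f y by rewrite linearD.
have fZ c x : f (c *: x) = c * f x by rewrite linearZ.
have f0 : f 0 = 0 :> R[i] by rewrite linear0.
have fN x : f (- x) = - f x :> R[i] by rewrite linearN.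
pose J y := nr y ^+ 2 - 2 * complex.Re (f y).
have JD x y (t : R) : J (x + t%:C *: y) = J x +
    2 * t * (complex.Re '[x, y] - complex.Re (f y)) + t ^+ 2 * nr y ^+ 2.
  rewrite /J nr2D fD fZ innerZr !ReD !ReZ.
  have -> : nr (t%:C *: y) ^+ 2 = t ^+ 2 * nr y ^+ 2.
    rewrite !nr2 innerZl innerZr conjc_real !ReZ; ring.
  ring.
have Jlb y : - M ^+ 2 <= J y.
  rewrite /J; have := le_trans (ReE (f y)) (fM y); have := sqr_ge0 (nr y - M).
  nra.
pose E := range J.
have Einf : has_inf E.
  by split; [exists (J 0); exists 0|exists (- M ^+ 2) => _ [y _ <-]].
pose m := inf E.
have mJ y : m <= J y by apply: ge_inf; [exact: Einf.2|exists y].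
have /choice[u uP] (n : nat) : exists y, J y < m + n.+1%:R^-1.
  have [|_ [y _ <-] ?] := @inf_adherent _ E n.+1%:R^-1 _ Einf.
    by rewrite invr_gt0.
  by exists y.
have par x y : nr (x - y) ^+ 2 <= 2 * (J x - m) + 2 * (J y - m).
  have e : y + (2^-1)%:C *: (x - y) = x - (2^-1)%:C *: (x - y).
    have h : 2^-1 + 2^-1 = 1 :> R by lra.
    have h' : (2^-1)%:C + (2^-1)%:C = 1 :> R[i] by rewrite -[LHS]rmorphD h.
    apply/eqP; rewrite eq_sym subr_eq -addrA -scalerDl h' scale1r.
    by rewrite addrC subrK.
  have h1 := mJ (y + (2^-1)%:C *: (x - y)).
  have Jx : J x = J (y + 1%:C *: (x - y)) by rewrite scale1r addrC subrK.
  rewrite JD in Jx; rewrite JD in h1; rewrite Jx; nra.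
have ucau : cauchy (u @ \oo).
  apply: cauchy_exP => e e0.
  have eE : e = (complex.Re e)%:C by rewrite RRe_real// gtr0_real.
  have eR0 : 0 < complex.Re e by rewrite -ltcR -eE.
  set d := complex.Re e in eR0 eE.
  have [N NP] : exists N : nat, N.+1%:R^-1 < d ^+ 2 / 4.
    have d4 : 0 < d ^+ 2 / 4 by rewrite divr_gt0// exprn_gt0.
    have [N _ /(_ N (leqnn _))/= hN] := near_infty_natSinv_lt (PosNum d4).
    by exists N.
  exists (u N); exists N => // n /= Nn; rewrite -ball_normE/= eE nrE ltcR.
  have nN : n.+1%:R^-1 <= N.+1%:R^-1 :> R by rewrite lef_pV2 ?posrE// ler_nat.
  rewrite -(@ltr_pXn2r _ 2)// ?nnegrE//; last exact: ltW.
  apply: le_lt_trans (par _ _) _.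
  have := uP N; have := uP n; move: NP nN.
  move: (N.+1%:R^-1) (n.+1%:R^-1) => a b; lra.
have uz : u @ \oo --> lim (u @ \oo) by exact: cauchy_cvg.
set z := lim _ in uz.
have main v : 0 <= complex.Re '[z, v] - complex.Re (f v).
  rewrite leNgt; apply/negP => w0; set w := _ - _ in w0.
  have [nv0|nv0] := eqVneq (nr v) 0.
    have v0 : v = 0 by apply/normr0_eq0; rewrite nrE nv0.
    by move: w0; rewrite /w v0 inner0r f0 subrr ltxx.
  have {}nv0 : 0 < nr v by rewrite lt_neqAle eq_sym nv0 nr_ge0.
  (* choose t *)
  pose t := - w / (2 * nr v ^+ 2).
  have t0 : 0 < t by rewrite divr_gt0 ?mulr_gt0 ?exprn_gt0// oppr_gt0.
  have d0 : 0 < - w / (4 * nr v) by rewrite divr_gt0 ?oppr_gt0 ?mulr_gt0.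
  have d0C : 0 < (- w / (4 * nr v))%:C by rewrite ltcR.
  have e0 : 0 < - w * t / 4 by rewrite divr_gt0// mulr_gt0// oppr_gt0.
  near \oo => n.
  have h1 : nr (z - u n) < - w / (4 * nr v).
    rewrite -ltcR -nrE; near: n.
    by apply: pseudometric_normed_Zmodule.cvgr_dist_lt => //; exact: uz.
  have h2 : n.+1%:R^-1 < - w * t / 4.
    by near: n; exact: (near_infty_natSinv_lt (PosNum e0)).
  have := mJ (u n + t%:C *: v); rewrite JD => h3.
  have h4 := uP n.
  have h5 := cauchy_schwarzR (z - u n) v.
  rewrite innerBl ReD ReN in h5.
  have h6 : nr (z - u n) * nr v < - w / 4.
    have -> : - w / 4 = - w / (4 * nr v) * nr v by field; rewrite gt_eqF.
    by rewrite ltr_pM2r.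
  have h7 : t * nr v ^+ 2 = - w / 2 by rewrite /t; field; rewrite gt_eqF.
  have h8 := le_lt_trans h5 h6.
  move: h8; rewrite ltr_norml => /andP[h8 _].
  have h9 : complex.Re '[u n, v] - complex.Re (f v) < 3 / 4 * w.
    rewrite /w in h8 *; lra.
  have h10 : t ^+ 2 * nr v ^+ 2 = t * (- w / 2) by rewrite -h7; ring.
  rewrite h10 in h3.
  suff: t * (complex.Re '[u n, v] - complex.Re (f v)) <= t * (3 / 4 * w).
    move=> h11; have tw : t * w < 0 by rewrite pmulr_rlt0.
    move: h2 h3 h4 h11 tw; clear; move: (n.+1%:R^-1) (J _) (m).
    move: (complex.Re _ - complex.Re _) (w) (t).
    move=> X W T r j mm h2 h3 h4 h11 tw.
    lra.
  by rewrite ler_pM2l// ltW.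
have {}main v : complex.Re '[z, v] = complex.Re (f v).
  have := main v; have := main (- v); rewrite innerNr fN !ReN; lra.
exists z => y; apply/eqP; rewrite eq_complex main eqxx/=.
have := main ('i%C *: y); rewrite innerZr fZ (mulrC 'i%C) ReiNIm.
rewrite (mulrC 'i%C) ReiNIm.
by move=> /oppr_inj ->.
Unshelve. all: by end_near. Qed.

End HilbertTheory.

Section BoundedOperators.
Variables (R : realType) (H : hilbertType R).
Implicit Types (x y z : H) (c : R[i]).

Definition bounded_linear (f : H -> H) : Prop :=
  linear f /\ exists M : R[i], forall x, `|f x| <= M * `|x|.

Definition bounded_linear_pred : {pred H -> H} :=
  [pred f | `[< bounded_linear f >]].

Lemma bounded_linearP f : f \in bounded_linear_pred <-> bounded_linear f.
Proof. by split=> h; [exact: asboolW h|exact: asboolT h]. Qed.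

Let bounded_linear_submod : submod_closed bounded_linear_pred.
Proof.
split=> [|c f g].
  apply/bounded_linearP; split; first by move=> d x y; rewrite scaler0 addr0.
  by exists 0 => x; rewrite normr0 mul0r.
move=> /bounded_linearP[lf [M fM]] /bounded_linearP[lg [N gN]]; 
apply/bounded_linearP; split.
  move=> d x y.
  change (c *: f (d *: x + y) + g (d *: x + y) =
          d *: (c *: f x + g x) + (c *: f y + g y)).
  by rewrite lf lg !scalerDr !scalerA (mulrC c) addrACA.
exists (`|c| * M + N) => x.
rewrite (le_trans (ler_normD _ _))// mulrDl lerD//.
by rewrite normrZ -mulrA ler_wpM2l.
Qed.

HB.instance Definition _ :=
  GRing.isSubmodClosed.Build R[i] (H -> H) bounded_linear_pred
    bounded_linear_submod.

Record bounded_operator := BoundedOperator {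
  operator_fun :> H -> H;
  operator_funP : operator_fun \in bounded_linear_pred
}.

HB.instance Definition _ := [isSub for operator_fun].
HB.instance Definition _ := [Choice of bounded_operator by <:].
HB.instance Definition _ := [SubChoice_isSubLmodule of bounded_operator by <:].

Implicit Types S T : bounded_operator.

Let operator_linear T : linear T.
Proof. by have /bounded_linearP[] := operator_funP T. Qed.

HB.instance Definition _ T :=
  GRing.isLinear.Build R[i] H H *:%R T (@operator_linear T).

Lemma operator_bound T : exists M : R[i], forall x, `|T x| <= M * `|x|.
Proof. by have /bounded_linearP[] := operator_funP T. Qed.

Lemma operatorP S T : S =1 T <-> S = T.
Proof. by split=> [eST|->//]; apply/val_inj/funext. Qed.

Lemma operatorD S T x : (S + T) x = S x + T x.
Proof. by []. Qed.

Lemma operatorZ c T x : (c *: T) x = c *: T x.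
Proof. by []. Qed.

Let adjoint_ex T x : exists z, forall y, '[z, y] = '[x, T y].
Proof.
pose f (y : H) : R[i]^o := '[x, T y].
have lf : linear f.
  by move=> c y z; rewrite /f linearP innerDr innerZr.
pose fL := HB.pack_for {linear H -> R[i]^o} f
  (GRing.isLinear.Build R[i] H R[i]^o *:%R f lf).
have [M TM] := operator_bound T.
apply: (@riesz_representation _ _ fL); exists (`|x| * M) => y.
rewrite (le_trans (cauchy_schwarz _ _))// -mulrA; exact: ler_wpM2l.
Qed.

Definition adjoint_fun T x := xget 0 [set z | forall y, '[z, y] = '[x, T y]].

Let adjoint_funP T x y : '[adjoint_fun T x, y] = '[x, T y].
Proof.
rewrite /adjoint_fun; case: xgetP => [z -> //|no].
by have [z zP] := adjoint_ex T x; case: (no z).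
Qed.

Let adjoint_subproof T : adjoint_fun T \in bounded_linear_pred.
Proof.
apply/bounded_linearP; split.
  move=> c x y; apply: inner_inj => z.
  by rewrite innerDl innerZl !adjoint_funP -innerZl -innerDl.
have [M TM] := operator_bound T; exists M => x.
have [->|n0] := eqVneq (adjoint_fun T x) 0.
  rewrite normr0; have [->|x0] := eqVneq x 0; first by rewrite normr0 mulr0.
  exact/(le_trans _ (TM x)).
rewrite -(@ler_pM2r _ `|adjoint_fun T x|) ?normr_gt0// -expr2 -inner_norm.
rewrite adjoint_funP -[leLHS]ger0_norm; last first.
  by rewrite -adjoint_funP inner_norm exprn_ge0.
rewrite (le_trans (cauchy_schwarz _ _))// mulrAC mulrC; exact: ler_wpM2r.
Qed.

Definition adjoint T : bounded_operator := @BoundedOperator _ (adjoint_subproof T).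

Lemma adjointP T x y : '[adjoint T x, y] = '[x, T y].
Proof. exact: adjoint_funP. Qed.

Let comp_subproof S T : S \o T \in bounded_linear_pred.
Proof.
apply/bounded_linearP; split; first by move=> c x y /=; rewrite !linearP.
have [M SM] := operator_bound S; have [N TN] := operator_bound T.
exists (`|M| * N) => x; rewrite (le_trans (SM _))// -mulrA.
rewrite (@le_trans _ _ (`|M| * `|T x|))//; last exact: ler_wpM2l.
have := le_trans (normr_ge0 _) (SM (T x)) => h.
by rewrite -[X in _ <= _ * X]normr_id -normrM ger0_norm.
Qed.

Definition op_comp S T : bounded_operator := @BoundedOperator _ (comp_subproof S T).

Let op_compA : associative op_comp.
Proof. by move=> S T U; apply/operatorP. Qed.

Let op_compDl : left_distributive op_comp +%R.
Proof. by move=> S T U; apply/operatorP. Qed.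

Let op_compDr : right_distributive op_comp +%R.
Proof. by move=> S T U; apply/operatorP => x; exact: (raddfD S). Qed.

Let op_compZl c S T : op_comp (c *: S) T = c *: op_comp S T.
Proof. exact/operatorP. Qed.

Let op_compZr c S T : op_comp S (c *: T) = c *: op_comp S T.
Proof. by apply/operatorP => x; exact: (linearZ_LR S). Qed.

Let adjointK : involutive adjoint.
Proof.
move=> T; apply/operatorP => x; apply: inner_inj => y.
by rewrite adjointP innerC adjointP -innerC.
Qed.

Let adjointD : {morph adjoint : S T / S + T}.
Proof.
move=> S T; apply/operatorP => x; apply: inner_inj => y.
by rewrite adjointP !operatorD innerDl !adjointP innerDr.
Qed.

Let adjointZ c T : adjoint (c *: T) = conjc c *: adjoint T.
Proof.
apply/operatorP => x; apply: inner_inj => y.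
by rewrite adjointP !operatorZ innerZl adjointP innerZr conjcK.
Qed.

Let adjointM S T : adjoint (op_comp S T) = op_comp (adjoint T) (adjoint S).
Proof.
by apply/operatorP => x; apply: inner_inj => y; rewrite /= !adjointP.
Qed.

HB.instance Definition _ := isStarAlgebra.Build R bounded_operator
  op_compA op_compDl op_compDr op_compZl op_compZr
  adjointK adjointD adjointZ adjointM.

Lemma operatorM S T x : amul S T x = S (T x).
Proof. by []. Qed.

Lemma starP T x y : '[star T x, y] = '[x, T y].
Proof. exact: adjointP. Qed.

End BoundedOperators.

Section Dimension.
Variables (R : realType) (V : lmodType R[i]).

Definition lin_span n (v : 'I_n -> V) : set V :=
  range (fun c : 'I_n -> R[i] => \sum_i c i *: v i).

Definition lin_indep n (v : 'I_n -> V) : Prop :=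
  forall c : 'I_n -> R[i], \sum_i c i *: v i = 0 -> forall i, c i = 0.

Definition has_dim (S : set V) (d : nat) : Prop :=
  exists2 e : 'I_d -> V, lin_indep e & lin_span e = S.

End Dimension.

Section Projections.
Variables (R : realType) (H : hilbertType R).

Definition orthonormal (E : set H) : Prop :=
  forall x y, E x -> E y -> '[x, y] = (x == y)%:R.

Definition orthonormal_basis (E : set H) : Prop :=
  orthonormal E /\ forall F, E `<` F -> ~ orthonormal F.

Lemma orthonormal_basis_exists : exists E, orthonormal_basis E.
Proof.
apply: Zorn_bigcup => F FP Ftot x y [X FX Xx] [Y FY Yy].
by have [XY|YX] := Ftot _ _ FX FY; [apply: (FP _ FY)|apply: (FP _ FX)];
  do ?[exact: XY|exact: YX].
Qed.

Definition chosen_basis : set H := sval (cid orthonormal_basis_exists).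

Lemma chosen_basisP : orthonormal_basis chosen_basis.
Proof. exact: svalP. Qed.

(* Trace of a positive operator, in [0, +oo]; the value does not depend on the
   orthonormal basis. *)
Definition trace (T : bounded_operator H) : \bar R :=
  \esum_(e in chosen_basis) (complex.Re '[e, T e])%:E.

Definition Proj (k : nat) : set (bounded_operator H) :=
  [set p | [/\ star p = p, amul p p = p & (trace p <= k%:R%:E)%E]].

End Projections.

Section Compression.
Variables (R : realType) (A : starAlgType R) (H : hilbertType R).

Definition compression (p : bounded_operator H) (phi : A -> bounded_operator H)
  (a : A) : bounded_operator H := amul (amul p (phi a)) p.

Variables (p : bounded_operator H) (phi : {linear A -> bounded_operator H}).

Let compression_linear : linear (compression p phi).
Proof.
by move=> c x y; rewrite /compression linearP amulDr amulZr amulDl amulZl.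
Qed.

HB.instance Definition _ :=
  GRing.isLinear.Build R[i] A (bounded_operator H) *:%R (compression p phi)
    compression_linear.

End Compression.

(* Main.v *)
(* A matrix of operators is positive exactly when its quadratic form is
   nonnegative: on the Hilbert sum [H^n], a positive operator [T] has a square
   root [B], and the entries of [B] give the factorization. The square root
   comes from a contraction [S = 1 - T / M] and the monotone iteration
   [Y := (S + Y^2) / 2], whose limit satisfies [(1 - Y)^2 = 1 - S].

   (i) => (ii): write the vectors [xi_i] in terms of [k] vectors [f_m]. If
   [a = b^* b], the form is a sum over the rows [v] of [b] of forms
   [sum_(m, l) <f_m, phi (w_m^* w_l) f_l>] with [w] a tuple of [k] combinations
   of the entries of [v], and [[w_m^* w_l]] is positive in [M_k(A)].
   (ii) => (iii): the vectors [p xi_i] span a space of dimension at most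
   [Tr p <= k], by Parseval. (iii) => (i): take for [p] the projection on the
   span of the [k] vectors, obtained by Gram-Schmidt. *)
Require Import Defs.
From HB Require Import structures.
From mathcomp Require Import all_boot all_order all_algebra.
From mathcomp Require Import complex finmap lra ring.
From mathcomp Require Import all_classical all_reals all_analysis.

Set Implicit Arguments.
Unset Strict Implicit.
Unset Printing Implicit Defensive.

Import Order.TTheory GRing.Theory Num.Theory.
Import numFieldNormedType.Exports.

Local Open Scope classical_set_scope.
Local Open Scope complex_scope.
Local Open Scope ring_scope.

(** * Conjugation of nonnegative scalars, differences under the star, and finite sums in inner
    products *)

Lemma conjc_ge0 (R : rcfType) (c : R[i]) : 0 <= c -> conjc c = c.
Proof.
by case: c => a b; rewrite lecE /= => /andP[/eqP -> _]; rewrite oppr0.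
Qed.

Lemma starB (R : realType) (A : starAlgType R) :
  {morph @star R A : x y / x - y}.
Proof.
by move=> x y; rewrite -scaleN1r starD starZ rmorphN rmorph1 scaleN1r.
Qed.

Section InnerSums.
Variables (R : realType) (H : hilbertType R).
Implicit Types x y z : H.

Lemma inner_sumr (I : Type) (r : seq I) (P : pred I) (F : I -> H) x :
  '[x, \sum_(i <- r | P i) F i] = \sum_(i <- r | P i) '[x, F i].
Proof.
by apply: (big_morph (inner x)) => [y z|]; rewrite ?innerDr ?inner0r.
Qed.

Lemma inner_suml (I : Type) (r : seq I) (P : pred I) (F : I -> H) x :
  '[\sum_(i <- r | P i) F i, x] = \sum_(i <- r | P i) '[F i, x].
Proof.
by apply: (big_morph (fun y => '[y, x])) => [y z|]; rewrite ?innerDl ?inner0l.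
Qed.

Lemma operatorB (S T : bounded_operator H) x : (S - T) x = S x - T x.
Proof. by []. Qed.

Lemma operator_sum (I : Type) (r : seq I) (P : pred I)
    (F : I -> bounded_operator H) x :
  (\sum_(i <- r | P i) F i) x = \sum_(i <- r | P i) F i x.
Proof. by apply: (big_morph (fun T : bounded_operator H => T x)). Qed.

End InnerSums.

(** * Finite Hilbert sums *)

(* An alias, since ['I_n -> H] already carries the uniform structure of the
   library; [hsum H n] gets the [l^2] norm. *)
Definition hsum (R : realType) (H : hilbertType R) (n : nat) := 'I_n -> H.

Section DirectSum.
Variables (R : realType) (H : hilbertType R) (n : nat).

HB.instance Definition _ := GRing.Lmodule.copy (hsum H n) ('I_n -> H).

Implicit Types (u v w : hsum H n) (c : R[i]).

Definition hsum_inner u v : R[i] := \sum_i '[u i, v i].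
Definition hsum_norm u : R[i] := sqrtC (hsum_inner u u).

Let innerD u v w : hsum_inner u (v + w) = hsum_inner u v + hsum_inner u w.
Proof. by rewrite -big_split; apply: eq_bigr => i _; rewrite innerDr. Qed.

Let innerZ c u v : hsum_inner u (c *: v) = c * hsum_inner u v.
Proof. by rewrite mulr_sumr; apply: eq_bigr => i _; rewrite innerZr. Qed.

Let inner_conj u v : hsum_inner v u = conjc (hsum_inner u v).
Proof. by rewrite rmorph_sum; apply: eq_bigr => i _; rewrite innerC. Qed.

Let norm2 u : hsum_norm u ^+ 2 = \sum_i `|u i| ^+ 2.
Proof. by rewrite sqrtCK; apply: eq_bigr => i _; rewrite inner_norm. Qed.

Let inner_norm2 u : hsum_inner u u = hsum_norm u ^+ 2.
Proof. by rewrite sqrtCK. Qed.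

Let norm_ge0 u : 0 <= hsum_norm u.
Proof.
rewrite sqrtC_ge0; apply: sumr_ge0 => i _.
by rewrite inner_norm exprn_ge0.
Qed.

Let norm0_eq0 u : hsum_norm u = 0 -> u = 0.
Proof.
move=> /(congr1 (fun x => x ^+ 2)); rewrite norm2 expr0n => /eqP.
rewrite psumr_eq0 => [/allP h|i _]; last exact: exprn_ge0.
apply/funext => i; apply/eqP; rewrite -normr_eq0 -sqrf_eq0.
by apply: h; rewrite mem_index_enum.
Qed.

Let innerDl' u v w : hsum_inner (u + v) w = hsum_inner u w + hsum_inner v w.
Proof. by rewrite inner_conj innerD rmorphD/= -!inner_conj. Qed.

Let innerZl' c u v : hsum_inner (c *: u) v = conjc c * hsum_inner u v.
Proof. by rewrite inner_conj innerZ rmorphM/= -inner_conj. Qed.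

(** With [a], [b] the norms of [u], [v], expanding [0 <= |b u - a v|^2] gives
    [0 <= a b (2 a b - 2 Re <u, v>)], that is Cauchy-Schwarz once [a b] is cancelled; hence the
    separate cases [a = 0] and [b = 0]. *)
Let normD u v : hsum_norm (u + v) <= hsum_norm u + hsum_norm v.
Proof.
set a := hsum_norm u; set b := hsum_norm v.
have age0 : 0 <= a by exact: norm_ge0.
have bge0 : 0 <= b by exact: norm_ge0.
have [a0|a0] := eqVneq a 0.
  by rewrite a0 (norm0_eq0 a0) !add0r.
have [b0|b0] := eqVneq b 0.
  by rewrite b0 (norm0_eq0 b0) !addr0.
rewrite -(@ler_pXn2r _ 2)// ?nnegrE ?norm_ge0 ?addr_ge0//.
have ab : 0 < a * b by rewrite lt_neqAle eq_sym mulf_neq0// mulr_ge0.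
have conj_norm w : conjc (hsum_norm w) = hsum_norm w.
  exact/conjc_ge0/norm_ge0.
have : 0 <= hsum_inner (b *: u + (- a) *: v) (b *: u + (- a) *: v).
  by rewrite inner_norm2 exprn_ge0.
rewrite -inner_norm2 !innerD !innerDl' !innerZ !innerZl' !inner_norm2 -/a -/b.
rewrite rmorphN/= !conj_norm -/a -/b.
set x := hsum_inner u v; set y := hsum_inner v u => h.
have : 0 <= a * b * (2 * (a * b) - (x + y)).
  by apply: le_trans h _; rewrite le_eqVlt; apply/orP; left; apply/eqP; ring.
rewrite pmulr_rge0// subr_ge0 => {}h.
have -> : a ^+ 2 + y + (x + b ^+ 2) = (x + y) + (a ^+ 2 + b ^+ 2) by ring.
have -> : (a + b) ^+ 2 = 2 * (a * b) + (a ^+ 2 + b ^+ 2) by ring.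
by rewrite lerD2r.
Qed.

Let normZ c u : hsum_norm (c *: u) = `|c| * hsum_norm u.
Proof.
apply/eqP; rewrite -(@eqrXn2 _ 2)// ?mulr_ge0 ?norm_ge0//.
rewrite exprMn !norm2 mulr_sumr.
by apply/eqP/eq_bigr => i _; rewrite normrZ exprMn.
Qed.

HB.instance Definition _ := Lmodule_isNormed.Build R[i] (hsum H n)
  normD normZ norm0_eq0.

Let hsum_normE u : `|u| = hsum_norm u. Proof. by []. Qed.

Lemma hsum_coord_le u i : `|u i| <= `|u|.
Proof.
rewrite -(@ler_pXn2r _ 2)// ?nnegrE// hsum_normE norm2 (bigD1 i)//= lerDl.
by apply: sumr_ge0 => j _; exact: exprn_ge0.
Qed.

(** Together with [hsum_coord_le], this reduces convergence and boundedness in the sum to the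
    coordinates. *)
Lemma hsum_norm_le_sum u : `|u| <= \sum_i `|u i|.
Proof.
rewrite -(@ler_pXn2r _ 2)// ?nnegrE ?sumr_ge0// hsum_normE norm2.
suff [] : 0 <= \sum_i `|u i| /\
    \sum_i `|u i| ^+ 2 <= (\sum_i `|u i|) ^+ 2 by [].
elim/big_rec2 : _ => [|i x y _ [y0 xy]]; rewrite ?expr0n//.
split; first exact: addr_ge0.
rewrite sqrrD -addrA lerD2l (le_trans xy)// lerDr.
by rewrite mulrn_wge0// mulr_ge0.
Qed.

Let complete (F : set_system (hsum H n)) : ProperFilter F -> cauchy F -> cvg F.
Proof.
move=> FF /cauchy_ballP Fc.
have cvgi i : cvg ((fun u : hsum H n => u i) @ F).
  apply: cauchy_cvg; apply/cauchy_ballP => e e0; rewrite near_map2.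
  apply: filterS (Fc e e0) => -[u v]/=.
  rewrite -!ball_normE/=; apply: le_lt_trans.
  exact: (hsum_coord_le (u - v)).
pose l : hsum H n := fun i => lim ((fun u : hsum H n => u i) @ F).
apply/cvg_ex; exists l; apply/cvgrPdist_lt => e e0.
(* Dividing by [n.+1] covers [n = 0] and keeps the total of the [n] coordinate errors strictly below
   [e]. *)
have e1 : 0 < e / n.+1%:R by rewrite divr_gt0.
near=> u.
apply: (@le_lt_trans _ _ (\sum_i `|(l - u) i|)); first exact: hsum_norm_le_sum.
apply: (@le_lt_trans _ _ (\sum_(i < n) e / n.+1%:R)).
  apply: ler_sum => i _; apply/ltW; move: i.
  near: u; apply: filter_forall => i.
  exact: (@cvgr_dist_lt _ _ _ _ _ _ _ (cvgi i) _ e1).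
rewrite sumr_const card_ord -[_ *+ n]mulr_natr -mulrA gtr_pMr//.
by rewrite mulrC ltr_pdivrMr// mul1r ltr_nat.
Unshelve. all: by end_near. Qed.

HB.instance Definition _ := Uniform_isComplete.Build (hsum H n) complete.

HB.instance Definition _ := isHilbert.Build R (hsum H n)
  innerD innerZ inner_conj inner_norm2.

Lemma hsum_innerE u v : '[u, v] = \sum_i '[u i, v i].
Proof. by []. Qed.

End DirectSum.

(** * Square roots of positive operators *)

Section PositiveSquareRoot.
Variables (R : realType) (K : hilbertType R).
Implicit Types (x y z : K) (c : R[i]) (S T : bounded_operator K).

Let id_subproof : (fun x : K => x) \in @bounded_linear_pred R K.
Proof. by apply/bounded_linearP; split=> //; exists 1 => x; rewrite mul1r. Qed.

Definition id_op : bounded_operator K := BoundedOperator id_subproof.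

Lemma star_id_op : star id_op = id_op.
Proof. by apply/operatorP => x; apply: inner_inj => y; rewrite starP. Qed.

(** A strictly positive bound can be inverted, which the rescaling of [T] to a contraction requires;
    adding 1 secures this even for the zero operator. *)
Lemma operator_norm_bound T :
  exists2 M : R[i], 0 < M & forall x, `|T x| <= M * `|x|.
Proof.
have [M TM] := operator_bound T; exists (`|M| + 1); first exact: ltr_wpDl.
move=> x; have := le_trans (normr_ge0 _) (TM x) => h.
rewrite (le_trans (TM x))// -(ger0_norm h) normrM normr_id mulrDl mul1r.
by rewrite lerDl.
Qed.

(** Polarization over the complex scalars: evaluating at [x + y] and at [x + i y] shows that the sum
    and the difference of [<x, T y>] and [<y, T x>] both vanish. *)
Lemma operator_form_eq0 T : (forall x, '[x, T x] = 0) -> T = 0.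
Proof.
move=> T0; apply/operatorP => y; apply: inner_inj => x.
rewrite innerC [RHS]innerC; congr (conjc _); rewrite inner0r.
have eD : '[x, T y] + '[y, T x] = 0.
  have := T0 (x + y); rewrite raddfD/= innerDl !innerDr !T0 addr0 add0r.
  by rewrite addrC => <-; rewrite addrC.
have eB : '[x, T y] - '[y, T x] = 0.
  have := T0 (x + 'i%C *: y); rewrite raddfD/= linearZ/=.
  rewrite innerDl !innerDr !innerZl !innerZr !T0 !mulr0 addr0 add0r.
  have -> : conjc 'i%C = - 'i%C :> R[i].
    by apply/eqP; rewrite eq_complex/= oppr0 !eqxx.
  rewrite mulNr -mulrBr => /eqP; rewrite mulf_eq0 => /orP[|/eqP//].
  by rewrite eq_complex/= oner_eq0 andbF.
have /eqP := congr2 +%R eD eB; rewrite addrACA subrr !addr0 -mulr2n.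
by rewrite mulrn_eq0 => /eqP.
Qed.

(** A nonnegative element of [R[i]] is real, so [star T] and [T] have the same quadratic form, and
    polarization applies to their difference. *)
Lemma star_of_form_ge0 T : (forall x, 0 <= '[x, T x]) -> star T = T.
Proof.
move=> T0; apply/eqP; rewrite -subr_eq0; apply/eqP/operator_form_eq0 => x.
by rewrite operatorB innerBr [X in X - _]innerC starP conjc_ge0// subrr.
Qed.

(** With [g = <x, T x>] and [q = |T x|^2], the squared norms differ by [M^-1 (g + M^-1 (M g - q))],
    so everything rests on [q <= M g]. *)
Lemma contraction_of_form_ge0 T (M : R[i]) : 0 < M ->
    (forall x, `|T x| <= M * `|x|) -> (forall x, 0 <= '[x, T x]) ->
  forall x, `|(id_op - M^-1 *: T) x| <= `|x|.
Proof.
move=> M0 TM T0 x; have sT := star_of_form_ge0 T0.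
have Mc : conjc M^-1 = M^-1 by rewrite conjc_ge0// invr_ge0 ltW.
have TT z w : '[T z, w] = '[z, T w] by rewrite -{1}sT starP.
set g := '[x, T x]; set q := '[T x, T x].
have g0 : 0 <= g by exact: T0.
have q0 : 0 <= q by rewrite /q inner_norm exprn_ge0.
(* [q <= M g] comes from [0 <= <z, T z>] at [z = x - M^-1 T x]. *)
have qMg : q <= M * g.
  have TTT : '[T x, T (T x)] <= M * q.
    rewrite -[leLHS]ger0_norm ?T0// (le_trans (cauchy_schwarz _ _))//.
    by rewrite /q inner_norm expr2 mulrCA ler_wpM2l// mulrC.
  have := T0 (x - M^-1 *: T x).
  rewrite (raddfB T)/= (linearZ_LR T)/= innerBl !innerBr !innerZl !innerZr Mc.
  rewrite -(TT x (T x)) -/q -/g => h; rewrite -subr_ge0.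
  have Mi : 0 <= M^-1 by rewrite invr_ge0 ltW.
  have {}TTT : M^-1 * (M^-1 * '[T x, T (T x)]) <= M^-1 * q.
    by rewrite ler_wpM2l// ler_pdivrMl.
  rewrite -(@pmulr_rge0 _ M^-1) ?invr_gt0// mulrBr mulKf ?gt_eqF//.
  by apply: le_trans h _; rewrite opprB gerDl subr_le0.
rewrite -(@ler_pXn2r _ 2)// ?nnegrE//.
rewrite -!inner_norm operatorB operatorZ innerBl !innerBr !innerZl !innerZr Mc.
rewrite TT -/g -/q -subr_ge0.
have -> : '[x, x] - ('[x, x] - M^-1 * g - (M^-1 * g - M^-1 * (M^-1 * q))) =
  M^-1 * (g + M^-1 * (M * g - q)) by field; rewrite gt_eqF.
by rewrite mulr_ge0 ?invr_ge0 ?addr_ge0 ?mulr_ge0 ?invr_ge0 ?subr_ge0// ltW.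
Qed.

(** * Fixed-point iteration for [1 - (1 - S)^(1/2)] *)

Section Iteration.
Variable S : bounded_operator K.
Hypotheses (starS : star S = S) (S1 : forall x, `|S x| <= `|x|).

(* Iterates for the fixed point [Y = (S + Y^2) / 2], that is
   [(1 - Y)^2 = 1 - S]; [iter_bound] is the same iteration with [S = 1]. *)
Fixpoint iter_op (m : nat) : bounded_operator K :=
  if m is m'.+1 then (2^-1)%:C *: (S + amul (iter_op m') (iter_op m')) else 0.

Fixpoint iter_bound (m : nat) : R :=
  if m is m'.+1 then 2^-1 * (1 + iter_bound m' ^+ 2) else 0.

Let b_ge0 m : 0 <= iter_bound m.
Proof.
case: m => [|m]/=; first by [].
by rewrite mulr_ge0 ?invr_ge0// addr_ge0// sqr_ge0.
Qed.

Let b_le1 m : iter_bound m <= 1.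
Proof.
elim: m => [|m ih]/=; first exact: ler01.
have := b_ge0 m; move: ih; nra.
Qed.

(** One step raises the value by [(iter_bound m - 1)^2 / 2]. *)
Let b_homo : {homo iter_bound : m n / (m <= n)%N >-> m <= n}.
Proof.
apply: homo_leq => [//|x y z|m]; first exact: le_trans.
by rewrite /=; have := sqr_ge0 (iter_bound m - 1); nra.
Qed.

Let starY m : star (iter_op m) = iter_op m.
Proof.
elim: m => [|m ih]/=; first exact: star0.
by rewrite starZ starD starS starM ih conjc_real.
Qed.

Let half_norm x : `|(2^-1 : R)%:C *: x| = (2^-1)%:C * `|x|.
Proof. by rewrite normrZ ger0_norm// lecR invr_ge0. Qed.

Let normY m x : `|iter_op m x| <= (iter_bound m)%:C * `|x|.
Proof.
elim: m x => [|m ih] x /=; first by rewrite normr0 mul0r.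
rewrite half_norm rmorphM -mulrA ler_wpM2l ?lecR ?invr_ge0//.
rewrite rmorphD rmorph1 mulrDl mul1r (le_trans (ler_normD _ _))// lerD//.
rewrite (le_trans (ih _))// expr2 rmorphM -mulrA ler_wpM2l// lecR; exact: b_ge0.
Qed.

(** Induction on [Y'^2 - Y^2 = Y' (Y' - Y) + (Y' - Y) Y], an identity valid for non-commuting
    operators. The scalar iteration satisfies the same identity, so its increments dominate. *)
Let normYS m x : `|iter_op m.+1 x - iter_op m x| <=
  (iter_bound m.+1 - iter_bound m)%:C * `|x|.
Proof.
elim: m x => [|m ih] x.
  have -> : iter_op 1 x - iter_op 0 x = (2^-1)%:C *: S x.
    by rewrite subr0; congr (_ *: _); exact: addr0.
  have -> : iter_bound 1 - iter_bound 0 = 2^-1.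
    by rewrite /= expr0n addr0 mulr1 subr0.
  by rewrite half_norm ler_wpM2l// lecR invr_ge0.
have -> : iter_op m.+2 x - iter_op m.+1 x = (2^-1)%:C *:
   (iter_op m.+1 (iter_op m.+1 x - iter_op m x) +
    (iter_op m.+1 (iter_op m x) - iter_op m (iter_op m x))).
  rewrite raddfB addrA subrK [LHS]/=.
  change ((2^-1)%:C *: (S x + iter_op m.+1 (iter_op m.+1 x)) -
     (2^-1)%:C *: (S x + iter_op m (iter_op m x)) = (2^-1)%:C *:
   (iter_op m.+1 (iter_op m.+1 x) - iter_op m (iter_op m x))).
  by rewrite -scalerBr opprD addrACA subrr add0r.
rewrite half_norm.
have -> : iter_bound m.+2 - iter_bound m.+1 = 2^-1 *
    (iter_bound m.+1 * (iter_bound m.+1 - iter_bound m) +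
     (iter_bound m.+1 - iter_bound m) * iter_bound m).
  by rewrite [iter_bound m.+2]/= -/(iter_bound m.+1) [X in _ - X]/=; field.
have d0 : 0 <= (iter_bound m.+1 - iter_bound m)%:C.
  by rewrite ler0c subr_ge0 b_homo.
rewrite rmorphM -mulrA ler_wpM2l ?lecR ?invr_ge0// (le_trans (ler_normD _ _))//.
rewrite rmorphD mulrDl (rmorphM _ (iter_bound m.+1)) (rmorphM _ (_ - _)).
rewrite -!mulrA.
rewrite lerD//.
  by rewrite (le_trans (normY _ _))// ler_wpM2l// ?ih// lecR b_ge0.
by rewrite (le_trans (ih _))// ler_wpM2l// normY.
Qed.

Let normYB m n x : (m <= n)%N -> `|iter_op n x - iter_op m x| <=
  (iter_bound n - iter_bound m)%:C * `|x|.
Proof.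
elim: n => [|n ih].
  by rewrite leqn0 => /eqP->; rewrite !subrr normr0 mul0r.
rewrite leq_eqVlt => /orP[/eqP->|]; first by rewrite !subrr normr0 mul0r.
rewrite ltnS => /ih{}ih.
rewrite -(subrKA (iter_op n x)) -(subrKA (iter_bound n)) rmorphD mulrDl.
by rewrite (le_trans (ler_normD _ _))// lerD.
Qed.

(** The scalar iterates increase and stay below 1, so past some [N] they vary little; [normYB]
    transfers this to the operators. *)
Let cauchyY x : cauchy ((fun m => iter_op m x) @ \oo).
Proof.
apply: cauchy_exP => e e0.
have eE : e = (complex.Re e)%:C by rewrite RRe_real// gtr0_real.
have xE : `|x| = (complex.Re `|x|)%:C by rewrite RRe_real// ger0_real.
set d := complex.Re e in eE; set r := complex.Re `|x| in xE.
have d0 : 0 < d by rewrite -ltcR -eE.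
have r0 : 0 <= r by rewrite -ler0c -xE.
have Es : has_sup (range iter_bound).
  by split; [exists (iter_bound 0%N); exists 0%N|exists 1 => _ [m _ <-]].
(* Adding 1 keeps the divisor positive when [x = 0]. *)
have dr0 : 0 < d / (r + 1) by rewrite divr_gt0// ltr_wpDl.
have [_ [N _ <-] hN] := sup_adherent dr0 Es.
exists (iter_op N x); exists N => // n /= Nn; rewrite -ball_normE/= distrC.
apply: le_lt_trans (normYB x Nn) _; rewrite eE xE -rmorphM ltcR.
have hn : iter_bound n <= sup (range iter_bound).
  by apply: (sup_upper_bound Es); exists n.
have : (iter_bound n - iter_bound N) * r <= d / (r + 1) * r.
  by rewrite ler_wpM2r//; lra.
move/le_lt_trans; apply.
by rewrite mulrAC ltr_pdivrMr ?ltr_wpDl// ltr_pM2l// ltrDl.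
Qed.

Let Yfun x : K := lim ((fun m => iter_op m x) @ \oo).

Let Yfun_cvg x : (fun m => iter_op m x) @ \oo --> Yfun x.
Proof. exact: cauchy_cvg. Qed.

Let Y_subproof : Yfun \in @bounded_linear_pred R K.
Proof.
apply/bounded_linearP; split.
  move=> c x y; apply: cvg_lim => //.
  under eq_fun do rewrite linearP.
  by apply: cvgD; [apply: cvgZl_tmp|]; exact: Yfun_cvg.
exists 1 => x; rewrite mul1r real_leNgt ?normr_real//; apply/negP => xY.
have : \forall m \near \oo, `|x| < `|iter_op m x|.
  by apply: cvgr_norm_gt xY; exact: Yfun_cvg.
move=> [N _ /(_ N (leqnn N))/=]; apply/negP; rewrite -real_leNgt ?normr_real//.
by rewrite (le_trans (normY _ _))// ler_piMl// lecR.
Qed.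

Let Y : bounded_operator K := BoundedOperator Y_subproof.

Let star_limit : star Y = Y.
Proof.
apply/operatorP => x; apply: inner_inj => z; rewrite starP.
apply/eqP; rewrite -subr_eq0 -normr_le0.
apply/ler_addgt0Pr => e e0; rewrite add0r.
have d0 : 0 < e / (2 * (`|x| + `|z| + 1)).
  by rewrite divr_gt0// mulr_gt0// ltr_wpDl// addr_ge0.
near \oo => m.
have hx : `|Y x - iter_op m x| <= e / (2 * (`|x| + `|z| + 1)).
  near: m; apply: cvgr_dist_le => //; exact: Yfun_cvg.
have hz : `|Y z - iter_op m z| <= e / (2 * (`|x| + `|z| + 1)).
  near: m; apply: cvgr_dist_le => //; exact: Yfun_cvg.
(* The self-adjoint iterate contributes equally to both inner products, so only the two
   approximation errors remain. *)
have -> : '[x, Y z] - '[Y x, z] =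
    '[x, Y z - iter_op m z] - '[Y x - iter_op m x, z].
  rewrite innerBr innerBl -[in X in _ - X - _](starP (iter_op m)) starY.
  by ring.
rewrite (le_trans (ler_normB _ _))//.
rewrite (le_trans (lerD (cauchy_schwarz _ _) (cauchy_schwarz _ _)))//.
rewrite (le_trans (lerD (ler_wpM2l _ hz) (ler_wpM2r _ hx)))// mulrC -mulrDr.
rewrite mulrAC ler_pdivrMr ?mulr_gt0 ?ltr_wpDl ?addr_ge0//.
rewrite ler_wpM2l//; first exact: ltW.
rewrite mulr_natl mulr2n -[leLHS]addr0 lerD// ?lerDl// ?addr_ge0//.
Unshelve. all: by end_near. Qed.

(** The recursion passes to the limit. Convergence is pointwise, so the product of iterates is
    handled by splitting [Y (Y x) - Y_m (Y_m x)] into [(Y - Y_m) (Y x)] and [Y_m (Y x - Y_m x)],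
    where all [Y_m] are contractions. *)
Lemma sqrt_fixpoint : exists2 Y : bounded_operator K,
  star Y = Y & Y = (2^-1)%:C *: (S + amul Y Y).
Proof.
exists Y => //; apply/operatorP => x; symmetry.
have h : (fun m => iter_op m (iter_op m x)) @ \oo --> Y (Y x).
  apply/cvgrPdist_lt => e e0; near=> m.
  have -> : Y (Y x) - iter_op m (iter_op m x) =
      (Y (Y x) - iter_op m (Y x)) + iter_op m (Y x - iter_op m x).
    by rewrite raddfB addrA subrK.
  rewrite (le_lt_trans (ler_normD _ _))// (splitr e) ltrD//.
    by near: m; apply: cvgr_dist_lt; [exact: Yfun_cvg|rewrite divr_gt0].
  apply: (@le_lt_trans _ _ `|Y x - iter_op m x|).
    by rewrite (le_trans (normY _ _))// ler_piMl// lecR.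
  by near: m; apply: cvgr_dist_lt; [exact: Yfun_cvg|rewrite divr_gt0].
have h1 : (fun m => iter_op m.+1 x) @ \oo --> (2^-1)%:C *: (S x + Y (Y x)).
  by apply: cvgZl_tmp; apply: cvgD => //; exact: cvg_cst.
have h2 : (fun m => iter_op m.+1 x) @ \oo --> Y x.
  by have := @Yfun_cvg x; rewrite -cvg_shiftS.
exact: cvg_unique h1 h2.
Unshelve. all: by end_near. Qed.

End Iteration.

Theorem positive_operatorP T : positive T <-> forall x, 0 <= '[x, T x].
Proof.
split=> [[B ->] x|T0].
  by rewrite operatorM innerC starP inner_norm conjc_ge0 exprn_ge0.
have [M M0 TM] := operator_norm_bound T.
have M1c : conjc M^-1 = M^-1 by rewrite conjc_ge0// invr_ge0 ltW.
have sS : star (id_op - M^-1 *: T) = id_op - M^-1 *: T.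
  by rewrite starB starZ M1c star_id_op star_of_form_ge0.
have [Y sY YE] := sqrt_fixpoint sS (contraction_of_form_ge0 M0 TM T0).
(* From [2 Y = S + Y^2] one gets [(1 - Y)^2 = 1 - S = M^-1 T]; the factor [sqrtC M] undoes the
   rescaling. *)
exists (sqrtC M *: (id_op - Y)).
have sMc : conjc (sqrtC M) = sqrtC M by rewrite conjc_ge0// sqrtC_ge0 ltW.
rewrite starZ sMc starB star_id_op sY amulZl amulZr scalerA -expr2 sqrtCK.
apply/operatorP => x.
change (T x = M *: (x - Y x - Y (x - Y x))).
have : (2 : R[i]) *: Y x = x - M^-1 *: T x + Y (Y x).
  rewrite {1}YE operatorZ scalerA.
  have -> : 2 * (2^-1)%:C = 1 :> R[i].
    by rewrite -[2](rmorph_nat (@real_complex R)) -rmorphM divff.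
  by rewrite scale1r.
rewrite scaler_nat mulr2n => h.
have -> : x - Y x - Y (x - Y x) = M^-1 *: T x.
  by rewrite (raddfB Y)/= opprB addrACA -opprD h [X in _ - X]addrAC subKr.
by rewrite scalerA mulfV ?gt_eqF// scale1r.
Qed.

End PositiveSquareRoot.

(** * Positive matrices of operators *)

Section PositiveOperatorMatrices.
Variables (R : realType) (H : hilbertType R).
Implicit Types (x y z : H).

Variable n : nat.

Definition hsum_inj (j : 'I_n) x : hsum H n := fun i => if i == j then x else 0.

Lemma hsum_inj_linear j : linear (hsum_inj j).
Proof.
move=> c x y; apply/funext => i.
change (hsum_inj j (c *: x + y) i = c *: hsum_inj j x i + hsum_inj j y i).
by rewrite /hsum_inj; case: eqP => // _; rewrite scaler0 addr0.
Qed.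

Lemma norm_hsum_inj_le j x : `|hsum_inj j x| <= `|x|.
Proof.
rewrite (le_trans (hsum_norm_le_sum _))// (bigD1 j)//= /hsum_inj eqxx.
by rewrite big1 ?addr0// => i /negPf->; rewrite normr0.
Qed.

Lemma inner_hsum_inj j x (u : hsum H n) : '[hsum_inj j x, u] = '[x, u j].
Proof.
rewrite hsum_innerE (bigD1 j)//= /hsum_inj eqxx big1 ?addr0// => i /negPf->.
by rewrite inner0l.
Qed.

Section Entries.
Variable (B : bounded_operator (hsum H n)).

Let entry_subproof i j :
  (fun x => B (hsum_inj j x) i) \in @bounded_linear_pred R H.
Proof.
apply/bounded_linearP; split.
  by move=> c x y; rewrite hsum_inj_linear linearP.
have [M M0 BM] := operator_norm_bound B; exists M => x.
rewrite (le_trans (hsum_coord_le _ _))// (le_trans (BM _))//.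
by rewrite ler_wpM2l ?norm_hsum_inj_le// ltW.
Qed.

Definition op_entry i j : bounded_operator H :=
  BoundedOperator (entry_subproof i j).

End Entries.

Section Assembly.
Variable (X : matalg (bounded_operator H) n).

Let assemble_fun (u : hsum H n) : hsum H n := fun i => \sum_j X i j (u j).

Let assemble_subproof : assemble_fun \in @bounded_linear_pred R (hsum H n).
Proof.
apply/bounded_linearP; split.
  move=> c u v; apply/funext => i.
  change (\sum_j X i j (c *: u j + v j) =
    c *: (\sum_j X i j (u j)) + \sum_j X i j (v j)).
  by rewrite scaler_sumr -big_split; apply: eq_bigr => j _; rewrite linearP.
have /choice[M MP] (ij : 'I_n * 'I_n) : exists M : R[i],
    0 < M /\ forall x, `|X ij.1 ij.2 x| <= M * `|x|.
  by have [M M0 ?] := operator_norm_bound (X ij.1 ij.2); exists M.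
exists (\sum_i \sum_j M (i, j)) => u.
rewrite (le_trans (hsum_norm_le_sum _))// mulr_suml ler_sum// => i _.
rewrite (le_trans (ler_norm_sum _ _ _))// mulr_suml ler_sum// => j _.
rewrite (le_trans ((MP (i, j)).2 _))// ler_wpM2l ?hsum_coord_le//.
exact/ltW/(MP (i, j)).1.
Qed.

Definition op_assemble : bounded_operator (hsum H n) :=
  BoundedOperator assemble_subproof.

Lemma inner_op_assemble u v :
  '[u, op_assemble v] = \sum_i \sum_j '[u i, X i j (v j)].
Proof. by rewrite hsum_innerE; apply: eq_bigr => i _; rewrite inner_sumr. Qed.

End Assembly.

Theorem positive_op_matrixP (X : matalg (bounded_operator H) n) :
  positive X <->
  forall xi : 'I_n -> H, 0 <= \sum_i \sum_j '[xi i, X i j (xi j)].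
Proof.
split=> [[B ->] xi|X0].
  (* The form of [B^* B] is a sum of squared norms, one for each row of [B]. *)
  suff -> : \sum_i \sum_j '[xi i, amul (star B) B i j (xi j)] =
      \sum_l '[\sum_i B l i (xi i), \sum_i B l i (xi i)].
    by apply: sumr_ge0 => l _; rewrite inner_norm exprn_ge0.
  under [RHS]eq_bigr do rewrite inner_suml.
  rewrite [RHS]exchange_big; apply: eq_bigr => i _ /=.
  under [RHS]eq_bigr do rewrite inner_sumr.
  rewrite [RHS]exchange_big; apply: eq_bigr => j _ /=.
  rewrite mxE operator_sum inner_sumr; apply: eq_bigr => l _.
  by rewrite !mxE operatorM -[LHS]starP starK.
have /positive_operatorP[B XB] (u : hsum H n) : 0 <= '[u, op_assemble X u].
  by rewrite inner_op_assemble; exact: X0.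
exists (\matrix_(i, j) op_entry B i j); apply/matrixP => i j.
apply/operatorP => y; apply: inner_inj => x.
rewrite [LHS]innerC [RHS]innerC; congr (conjc _).
(* Vectors concentrated in the summands [i] and [j] isolate [X i j] in the assembled operator;
   expanding the middle term over coordinates gives the [(i, j)] entry of the matrix product. *)
transitivity '[B (hsum_inj i x), B (hsum_inj j y)].
  have -> : '[B (hsum_inj i x), B (hsum_inj j y)] =
      '[hsum_inj i x, op_assemble X (hsum_inj j y)].
    by rewrite XB operatorM -[RHS]starP starK.
  rewrite inner_hsum_inj; congr ('[_, _]).
  rewrite [op_assemble X _ i](bigD1 j)//= /hsum_inj eqxx big1 ?addr0//.
  by move=> l /negPf->; rewrite raddf0.
rewrite hsum_innerE mxE operator_sum inner_sumr; apply: eq_bigr => l _.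
by rewrite !mxE operatorM -[RHS]starP starK.
Qed.

End PositiveOperatorMatrices.

(** * Orthonormal families and Parseval's identity *)

Section OrthonormalFamilies.
Variables (R : realType) (H : hilbertType R).
Implicit Types (x y z : H).

(* [`|v|] lives in [R[i]]; [sqn v] is the real number [`|v| ^+ 2]. *)
Definition sqn (V : normedModType R[i]) (v : V) : R := complex.Re (`|v| ^+ 2).

Lemma sqnE (V : normedModType R[i]) (v : V) : (sqn v)%:C = `|v| ^+ 2.
Proof. by rewrite RRe_real// ger0_real// exprn_ge0. Qed.

Lemma sqn_ge0 (V : normedModType R[i]) (v : V) : 0 <= sqn v.
Proof. by rewrite -ler0c sqnE exprn_ge0. Qed.

Lemma inner_sqn x : '[x, x] = (sqn x)%:C.
Proof. by rewrite sqnE inner_norm. Qed.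

Lemma sqn_innerC x y : sqn ('[x, y] : R[i]^o) = sqn ('[y, x] : R[i]^o).
Proof. by apply: (@complexI R); rewrite !sqnE innerC norm_conjC. Qed.

Section Family.
Variables (I : eqType) (r : seq I) (f : I -> H).
Hypothesis r_uniq : uniq r.
Hypothesis f_on : {in r &, forall i j, '[f i, f j] = (i == j)%:R}.

(** Indexing by a duplicate-free sequence serves both finite sets of basis vectors, with [f] the
    identity, and families over ['I_d]. *)
Definition proj_vec x : H := \sum_(i <- r) '[f i, x] *: f i.

Lemma inner_proj_vec x i : i \in r -> '[f i, proj_vec x] = '[f i, x].
Proof.
move=> ir; rewrite inner_sumr (bigD1_seq i)//= innerZr f_on// eqxx mulr1.
rewrite big_seq_cond big1 ?addr0// => j /andP[jr ji].
by rewrite innerZr f_on// eq_sym (negbTE ji) mulr0.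
Qed.

(** Pythagoras: the residual [x - proj_vec x] is orthogonal to every [f i]. *)
Lemma sqn_proj_vec x : sqn (x - proj_vec x) =
  sqn x - \sum_(i <- r) sqn ('[f i, x] : R[i]^o).
Proof.
apply: (@complexI R); rewrite rmorphB rmorph_sum/= -!inner_sqn innerBl.
rewrite [X in _ - X]inner_suml [X in _ - X]big_seq big1; last first.
  by move=> i ir; rewrite innerZl innerBr inner_proj_vec// subrr mulr0.
rewrite subr0 innerBr inner_sumr; congr (_ - _); apply: eq_bigr => i _.
by rewrite innerZr sqnE sqr_normc -innerC.
Qed.

Lemma sqn_proj_vecE x :
  sqn (proj_vec x) = \sum_(i <- r) sqn ('[f i, x] : R[i]^o).
Proof.
apply: (@complexI R); rewrite rmorph_sum/= -inner_sqn {1}/proj_vec inner_suml.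
apply: eq_big_seq => i ir; rewrite innerZl inner_proj_vec// sqnE sqr_normc.
by rewrite mulrC.
Qed.

Lemma bessel x : \sum_(i <- r) sqn ('[f i, x] : R[i]^o) <= sqn x.
Proof. by rewrite -subr_ge0 -sqn_proj_vec sqn_ge0. Qed.

End Family.

(** Otherwise [x], once normalized, could be adjoined to [E], against maximality. *)
Lemma orthonormal_basis_total (E : set H) x : orthonormal_basis E ->
  (forall e, E e -> '[e, x] = 0) -> x = 0.
Proof.
move=> [Eon Emax] xE; apply/eqP; apply: contrapT => /negP x0.
pose u := `|x|^-1 *: x.
have xr : conjc `|x|^-1 = `|x|^-1 by rewrite conjc_ge0// invr_ge0.
have uu : '[u, u] = 1.
  by rewrite innerZl innerZr inner_norm xr expr2 mulKf ?mulVf ?normr_eq0.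
have eu e : E e -> '[e, u] = 0 by move=> Ee; rewrite innerZr xE// mulr0.
have ue e : E e -> '[u, e] = 0 by move=> Ee; rewrite innerC eu// conjc0.
have uE e : E e -> (e == u) = false.
  move=> Ee; apply/eqP => eu'; move: (eu _ Ee); rewrite eu' uu => /eqP.
  by rewrite oner_eq0.
apply: (Emax (E `|` [set u])).
  split; first by move=> e Ee; left.
  by move=> /(_ u) h; have := uE u (h (or_intror erefl)); rewrite eqxx.
move=> y z [Ey|->] [Ez|->]; first exact: Eon.
- by rewrite eu// uE.
- by rewrite ue// eq_sym uE.
- by rewrite uu eqxx.
Qed.

Section Parseval.
Variables (E : set H) (Eb : orthonormal_basis E) (x : H).

Let cf e : R := sqn ('[e, x] : R[i]^o).

Let on (F : {fset H}) : [set` F] `<=` E ->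
  {in (F : seq H) &, forall e e', '[id e, id e'] = (e == e')%:R}.
Proof. by move=> FE e e' eF e'F; apply: Eb.1; exact: FE. Qed.

Let S (F : {fset H}) : R := \sum_(e <- F) cf e.

Let S_le (F : {fset H}) : [set` F] `<=` E -> S F <= sqn x.
Proof.
by move=> FE; apply: (@bessel _ (F : seq H) id); [exact: fset_uniq|exact: on].
Qed.

Let Ssup : R := sup [set S F | F in [set F : {fset H} | [set` F] `<=` E]].

Let hasS : has_sup [set S F | F in [set F : {fset H} | [set` F] `<=` E]].
Proof.
split; first by exists (S fset0), fset0 => // e /=; rewrite in_fset0.
by exists (sqn x) => _ [F FE <-]; exact: S_le.
Qed.

Let S_le_sup (F : {fset H}) : [set` F] `<=` E -> S F <= Ssup.
Proof. by move=> FE; apply: (sup_upper_bound hasS); exists F. Qed.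

Let S_homo (F G : {fset H}) : (F `<=` G)%fset -> S F <= S G.
Proof.
move=> FG; rewrite /S (big_fsetID _ (mem F) G)/=.
have -> : [fset e in G | e \in F]%fset = F.
  by apply/fsetP => e; rewrite !inE andb_idl// => /(fsubsetP FG).
by rewrite lerDl; apply: sumr_ge0 => e _; exact: sqn_ge0.
Qed.

(** Since [E] may be uncountable, an increasing sequence of finite subsets, obtained as cumulative
    unions of nearly optimal ones, stands in for the net of all finite subsets. *)
Lemma near_optimal_chain : exists2 G : nat -> {fset H},
  (forall n, [set` G n] `<=` E) /\
  (forall n m, (n <= m)%N -> (G n `<=` G m)%fset) &
  forall n, Ssup - n.+1%:R^-1 < S (G n).
Proof.
have /choice[F FP] (n : nat) : exists F : {fset H},
    [set` F] `<=` E /\ Ssup - n.+1%:R^-1 < S F.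
  have [|_ [F FE <-] ?] := @sup_adherent _ _ n.+1%:R^-1 _ hasS.
    by rewrite invr_gt0.
  by exists F.
pose G := fix G n := if n is m.+1 then (G m `|` F n)%fset else F 0%N.
exists G.
  split.
    elim=> [|n ih]; first exact: (FP 0%N).1.
    by move=> e /=; rewrite in_fsetU => /orP[/ih//|]; apply: (FP n.+1).1.
  move=> n m; elim: m => [|m ih].
    by rewrite leqn0 => /eqP->; exact: fsubset_refl.
  rewrite leq_eqVlt ltnS => /predU1P[->|/ih nm]; first exact: fsubset_refl.
  exact: fsubset_trans nm (fsubsetUl _ _).
move=> n; apply: lt_le_trans (FP n).2 _; apply: S_homo.
by case: n => [|n]/=; [exact: fsubset_refl|exact: fsubsetUr].
Qed.

Lemma parseval :
  (\esum_(e in E) (sqn ('[e, x] : R[i]^o))%:E = (sqn x)%:E)%E.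
Proof.
apply/eqP; rewrite eq_le; apply/andP; split.
  apply: ge_ereal_sup => _ [A [Af AE] <-] /=.
  rewrite fsbig_finite//= sumEFin lee_fin; apply: S_le.
  by move=> e /=; rewrite in_fset_set// inE; exact: AE.
(* The partial expansions [g n] of [x] along [G] are Cauchy, and the difference
   between [x] and their limit is orthogonal to [E], hence zero. *)
have [G [GE Ghomo] GS] := near_optimal_chain.
have onG n := on (GE n).
pose g n := proj_vec (G n) id x.
have gE n : sqn (x - g n) = sqn x - S (G n).
  by rewrite (sqn_proj_vec (fset_uniq _) (onG n)).
(* As [g n] is the projection of [g m] along [G n], the squared distance is [S (G m) - S (G n)], at
   most [Ssup - S (G n)]. *)
have gB n m : (n <= m)%N -> sqn (g m - g n) < n.+1%:R^-1.
  move=> nm; have eG e : e \in G n -> '[e, g m] = '[e, x].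
    move=> eGn; apply: (inner_proj_vec (fset_uniq _) (onG m)).
    exact: (fsubsetP (Ghomo _ _ nm)).
  have -> : g n = proj_vec (G n) id (g m).
    by rewrite /g /proj_vec; apply: eq_big_seq => e eGn; rewrite -/(g m) eG.
  rewrite (sqn_proj_vec (fset_uniq _) (onG n)).
  have -> : \sum_(e <- G n) sqn ('[e, g m] : R[i]^o) = S (G n).
    by apply: eq_big_seq => e eGn; rewrite eG.
  have -> : sqn (g m) = S (G m).
    by rewrite (sqn_proj_vecE (fset_uniq _) (onG m)).
  by have := S_le_sup (GE m); have := GS n; move: (n.+1%:R^-1 : R) => t; lra.
have ltn e : 0 < e :> R -> exists n : nat, n.+1%:R^-1 < e.
  move=> e0.
  have [N _ /(_ N (leqnn _))/= hN] := near_infty_natSinv_lt (PosNum e0).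
  by exists N.
have lt_sqn (V : normedModType R[i]) (v : V) (d : R[i]) :
    0 < d -> sqn v < complex.Re d ^+ 2 -> `|v| < d.
  move=> d0 vd; rewrite -(@ltr_pXn2r _ 2)// ?nnegrE//; last exact: ltW.
  have dE : d = (complex.Re d)%:C by rewrite RRe_real// gtr0_real.
  by rewrite -sqnE dE -rmorphXn ltcR.
have Re_gt0 (d : R[i]) : 0 < d -> 0 < complex.Re d ^+ 2.
  by rewrite ltcE => /andP[_ ?]; rewrite exprn_gt0.
have gcauchy : cauchy (g @ \oo).
  apply: cauchy_exP => d d0; have [N hN] := ltn _ (Re_gt0 _ d0).
  exists (g N); exists N => // n /= Nn; rewrite -ball_normE/= distrC.
  by apply: lt_sqn => //; apply: lt_trans (gB _ _ Nn) _.
have gl : g @ \oo --> lim (g @ \oo) by exact: cauchy_cvg.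
set l := lim _ in gl.
have xl : x - l = 0.
  apply: (orthonormal_basis_total Eb) => e Ee.
  (* For [e] in [G n] the coefficient vanishes. Otherwise adjoining [e] to [G n] adds [cf e] to a
     sum that stays below [Ssup] and was already within [n.+1%:R^-1] of it. *)
  have coord n : sqn ('[e, x - g n] : R[i]^o) <= n.+1%:R^-1.
    have [eG|eG] := boolP (e \in G n).
      rewrite innerBr (inner_proj_vec (fset_uniq _) (onG n) _ eG).
      by rewrite subrr /sqn normr0 expr0n/= invr_ge0.
    rewrite innerBr [X in _ - X]inner_sumr.
    rewrite big_seq big1 => [|e' e'G]; last first.
      rewrite innerZr (Eb.1 _ _ Ee (GE n _ e'G)).
      by case: eqP eG => [->|_ _]; rewrite ?e'G ?mulr0.
    have : S (e |` G n)%fset <= Ssup.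
      apply: S_le_sup => e' /=; rewrite in_fset1U => /orP[/eqP->//|]; exact: GE.
    rewrite /S big_fsetU1//= subr0 -/(S _) -/(cf e).
    by have := GS n; move: (n.+1%:R^-1 : R) => t; lra.
  apply/eqP; rewrite -normr_le0; apply/ler_addgt0Pr => d d0; rewrite add0r.
  have d2 : 0 < d / 2 by rewrite divr_gt0.
  have e1 : `|e| = 1.
    by apply/eqP; rewrite -(@eqrXn2 _ 2)// -inner_norm Eb.1// eqxx expr1n.
  near \oo => n.
  have -> : x - l = (x - g n) - (l - g n) by rewrite opprB addrA subrK.
  rewrite innerBr (splitr d) (le_trans (ler_normB _ _))// lerD//.
    apply/ltW/(@lt_sqn R[i]^o) => //; apply: le_lt_trans (coord n) _.
    near: n; exact: (near_infty_natSinv_lt (PosNum (Re_gt0 _ d2))).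
  rewrite (le_trans (cauchy_schwarz _ _))// e1 mul1r.
  by near: n; apply: cvgr_dist_le.
(* Since [g n] tends to [x], Pythagoras brings the finite sum over some [G n] within [e] of
   [sqn x]. *)
apply/lee_addgt0Pr => e e0.
have [n hn] : exists n, sqn (x - g n) < e.
  have [e' e'0 e'e] : exists2 e' : R[i], 0 < e' & complex.Re (e' ^+ 2) <= e.
    exists (Num.sqrt e)%:C; first by rewrite ltcR sqrtr_gt0.
    by rewrite -rmorphXn/= sqr_sqrtr// ltW.
  near \oo => n; exists n; apply: lt_le_trans e'e.
  have : `|x - g n| < e'.
    near: n; apply: cvgr_dist_lt => //.
    by move/eqP: xl; rewrite subr_eq0 => /eqP->.
  rewrite -(@ltr_pXn2r _ 2)// ?nnegrE//; last exact: ltW.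
  by rewrite ltcE => /andP[].
rewrite gE in hn.
have : ((sqn x)%:E <= (S (G n))%:E + e%:E)%E by rewrite -EFinD lee_fin; lra.
move/le_trans; apply; rewrite leeD2r//; apply: esum_ge.
exists [set` G n]; first by split => //; exact: GE.
by rewrite fsbig_finite//= set_fsetK sumEFin.
Unshelve. all: by end_near. Qed.

End Parseval.

End OrthonormalFamilies.

(** * Finite-rank projections *)

Section FiniteRank.
Variables (R : realType) (H : hilbertType R).
Implicit Types (x y z : H) (p : bounded_operator H).

Definition orthonormal_family d (f : 'I_d -> H) : Prop :=
  forall i j, '[f i, f j] = (i == j)%:R.

Lemma lin_span0 d (f : 'I_d -> H) : lin_span f 0.
Proof. by exists (fun=> 0) => //; rewrite big1// => i _; rewrite scale0r. Qed.

Lemma lin_span_linear d (f : 'I_d -> H) (c : R[i]) x y :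
  lin_span f x -> lin_span f y -> lin_span f (c *: x + y).
Proof.
move=> [a _ <-] [b _ <-]; exists (fun i => c * a i + b i) => //.
rewrite scaler_sumr -big_split; apply: eq_bigr => i _ /=.
by rewrite scalerDl scalerA.
Qed.

Lemma lin_span_sum d (f : 'I_d -> H) (I : Type) (r : seq I) (c : I -> R[i])
    (F : I -> H) : (forall i, lin_span f (F i)) ->
  lin_span f (\sum_(i <- r) c i *: F i).
Proof.
move=> fF; elim/big_rec : _ => [|i x _ fx]; first exact: lin_span0.
exact: lin_span_linear.
Qed.

Lemma lin_span_gen d (f : 'I_d -> H) i : lin_span f (f i).
Proof.
exists (fun j => (j == i)%:R) => //.
rewrite (bigD1 i)//= eqxx scale1r big1 ?addr0// => j /negPf->.
by rewrite scale0r.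
Qed.

Lemma sub_lin_span d d' (f : 'I_d -> H) (g : 'I_d' -> H) :
  (forall i, lin_span g (f i)) -> lin_span f `<=` lin_span g.
Proof. by move=> gf _ [a _ <-]; exact: lin_span_sum. Qed.

(** Induction peeling off the last vector. If its residual [x - q] is zero the family is kept
    unchanged, which is how dependent vectors make [d] smaller than [n]; otherwise the normalized
    residual is appended. *)
Lemma gram_schmidt n (xi : 'I_n -> H) : exists d (f : 'I_d -> H),
  [/\ (d <= n)%N, orthonormal_family f & lin_span f = lin_span xi].
Proof.
elim: n xi => [|n ih] xi; first by exists 0%N, xi; split=> // -[].
have [d [f [dn fo fxi]]] := ih (fun i => xi (lift ord_max i)).
pose x := xi ord_max; pose q := \sum_j '[f j, x] *: f j.
have fi_xi j : lin_span xi (f j).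
  have : lin_span f (f j) by exact: lin_span_gen.
  by rewrite fxi; apply: sub_lin_span => i; exact: lin_span_gen.
have xi_f i : lin_span f (xi (lift ord_max i)).
  by rewrite fxi; exact: (lin_span_gen (fun i => xi (lift ord_max i))).
have qf : lin_span f q by apply: lin_span_sum => j; exact: lin_span_gen.
have [r0|r0] := eqVneq (x - q) 0.
  exists d, f; split=> //; first exact: leqW.
  apply/seteqP; split; apply: sub_lin_span => // i.
  have [j ->|->] := unliftP ord_max i; first exact: xi_f.
  by move/eqP: r0; rewrite subr_eq0 /x => /eqP->.
pose u := `|x - q|^-1 *: (x - q).
pose g (i : 'I_d.+1) := if unlift ord_max i is Some j then f j else u.
have gl j : g (lift ord_max j) = f j by rewrite /g liftK.
have gm : g ord_max = u by rewrite /g unlift_none.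
have fu j : '[f j, u] = 0.
  have -> : '[f j, u] = `|x - q|^-1 * ('[f j, x] - '[f j, q]).
    by rewrite innerZr innerBr.
  have -> : '[f j, q] = '[f j, x].
    apply: (@inner_proj_vec _ _ _ (index_enum 'I_d)).
    - exact: index_enum_uniq.
    - by move=> i i' _ _; exact: fo.
    - exact: mem_index_enum.
  by rewrite subrr mulr0.
have uu : '[u, u] = 1.
  rewrite innerZl innerZr inner_norm conjc_ge0 ?invr_ge0// expr2.
  by rewrite mulKf ?mulVf ?normr_eq0.
exists d.+1, g; split => //.
  move=> i j; have [i' ->|->] := unliftP ord_max i;
    have [j' ->|->] := unliftP ord_max j; rewrite ?gl ?gm.
  - by rewrite fo (inj_eq lift_inj).
  - by rewrite fu eq_sym (negPf (neq_lift _ _)).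
  - by rewrite innerC fu conjc0 (negPf (neq_lift _ _)).
  - by rewrite uu eqxx.
have f_g : lin_span f `<=` lin_span g.
  by apply: sub_lin_span => j; rewrite -gl; exact: lin_span_gen.
apply/seteqP; split; apply: sub_lin_span => i.
  have [j ->|->] := unliftP ord_max i; rewrite ?gl ?gm//.
  rewrite /u -[X in lin_span _ X]addr0.
  apply: lin_span_linear; last exact: lin_span0.
  rewrite -scaleN1r addrC; apply: lin_span_linear; last exact: lin_span_gen.
  exact: lin_span_sum.
have [j ->|->] := unliftP ord_max i; first exact/f_g/xi_f.
have -> : xi ord_max = `|x - q| *: u + q.
  by rewrite scalerA mulfV ?normr_eq0// scale1r subrK.
apply: lin_span_linear; last exact: f_g.
by rewrite -gm; exact: lin_span_gen.
Qed.

Lemma orthonormal_lin_indep d (f : 'I_d -> H) :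
  orthonormal_family f -> lin_indep f.
Proof.
move=> fo c c0 i; have : '[f i, \sum_j c j *: f j] = 0 by rewrite c0 inner0r.
rewrite inner_sumr (bigD1 i)//= innerZr fo eqxx mulr1 big1 ?addr0// => j ji.
by rewrite innerZr fo eq_sym (negPf ji) mulr0.
Qed.

Let chosen_total : orthonormal_basis (@chosen_basis R H) := @chosen_basisP R H.

(** Exchanging the sums, which have nonnegative terms, leaves one Parseval identity for each unit
    vector [f j]. Both trace estimates below compare with this value. *)
Lemma esum_orthonormal d (f : 'I_d -> H) : orthonormal_family f ->
  (\esum_(e in @chosen_basis R H) (\sum_j sqn ('[e, f j] : R[i]^o))%:E =
   d%:R%:E)%E.
Proof.
move=> fo; under eq_esum do rewrite -sumEFin.
rewrite esum_sum; last by move=> e j _ _; rewrite lee_fin sqn_ge0.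
under eq_bigr do rewrite parseval//.
rewrite sumEFin; congr (_%:E); rewrite -[d in RHS]card_ord -sumr_const.
by apply: eq_bigr => j _; apply: (@complexI R); rewrite -inner_sqn fo eqxx.
Qed.

(** Term by term, [<e, p e> = |p e|^2], and Bessel bounds this below by the sum of
    [|<f j, p e>|^2 = |<f j, e>|^2]. *)
Lemma rank_le_trace p d (f : 'I_d -> H) : star p = p -> amul p p = p ->
  orthonormal_family f -> (forall j, p (f j) = f j) ->
  (d%:R%:E <= trace p)%E.
Proof.
move=> sp pp fo pf; rewrite -(esum_orthonormal fo); apply: le_esum => e _.
rewrite lee_fin.
have -> : '[e, p e] = (sqn (p e))%:C.
  by rewrite -{1}pp operatorM -starP sp inner_sqn.
rewrite [complex.Re _]/=.
apply: le_trans (bessel (index_enum_uniq _) _ _); last first.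
  by move=> i j _ _; exact: fo.
by apply: ler_sum => j _; rewrite -[in leLHS](pf j) -starP sp sqn_innerC.
Qed.

Section ProjectionOnFamily.
Variables (d : nat) (f : 'I_d -> H).
Hypothesis fo : orthonormal_family f.

Let proj_subproof :
  (fun x => \sum_j '[f j, x] *: f j) \in @bounded_linear_pred R H.
Proof.
apply/bounded_linearP; split.
  move=> c x y; rewrite scaler_sumr -big_split; apply: eq_bigr => j _ /=.
  by rewrite innerDr innerZr scalerDl scalerA.
exists (\sum_j `|f j| * `|f j|) => x.
rewrite (le_trans (ler_norm_sum _ _ _))// mulr_suml ler_sum// => j _.
by rewrite normrZ mulrAC ler_wpM2r// cauchy_schwarz.
Qed.

Definition proj_op : bounded_operator H := BoundedOperator proj_subproof.

Lemma proj_op_id x : lin_span f x -> proj_op x = x.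
Proof.
move=> [c _ <-]; apply: eq_bigr => j _; congr (_ *: _).
rewrite inner_sumr (bigD1 j)//= innerZr fo eqxx mulr1 big1 ?addr0// => i ij.
by rewrite innerZr fo eq_sym (negPf ij) mulr0.
Qed.

Lemma proj_op_Proj k : (d <= k)%N -> Proj k proj_op.
Proof.
move=> dk; split.
- apply/operatorP => x; apply: inner_inj => y; rewrite starP.
  rewrite inner_sumr inner_suml; apply: eq_bigr => j _.
  by rewrite innerZl innerZr -innerC mulrC.
- apply/operatorP => x; rewrite operatorM proj_op_id//.
  by apply: lin_span_sum => j; exact: lin_span_gen.
apply: (@le_trans _ _ d%:R%:E); last by rewrite lee_fin ler_nat.
(* Each diagonal term [<e, P e>] is the sum of the [|<e, f j>|^2]. *)
rewrite -(esum_orthonormal fo) /trace; apply: le_esum => e _.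
rewrite lee_fin inner_sumr raddf_sum ler_sum// => j _.
rewrite -[leRHS]/(complex.Re (sqn ('[e, f j] : R[i]^o))%:C) sqnE sqr_normc.
by rewrite innerZr mulrC -innerC.
Qed.

End ProjectionOnFamily.

(** Gram-Schmidt on the vectors [p (xi i)] yields orthonormal vectors fixed by [p], whose number is
    bounded by the trace. *)
Lemma has_dim_range_Proj k p n (xi : 'I_n -> H) : Proj k p ->
  exists2 d, (d <= k)%N & has_dim (lin_span (fun i => p (xi i))) d.
Proof.
move=> [sp pp tp]; have [d [f [_ fo fp]]] := gram_schmidt (fun i => p (xi i)).
exists d; last by exists f => //; exact: orthonormal_lin_indep.
rewrite -(ler_nat R) -lee_fin (le_trans _ tp)//.
apply: (rank_le_trace sp pp fo) => j.
have [c _ <-] : lin_span (fun i => p (xi i)) (f j).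
  by rewrite -fp; exact: lin_span_gen.
rewrite raddf_sum; apply: eq_bigr => i _.
by rewrite [LHS](linearZ_LR p)/= -operatorM pp.
Qed.

End FiniteRank.

(** * Quadratic forms of k-positive maps *)

Section CompressionForms.
Variables (R : realType) (A : starAlgType R) (H : hilbertType R).
Variable phi : {linear A -> bounded_operator H}.

Lemma positive_amplification n (X : matalg A n)
    (psi : {linear A -> bounded_operator H}) :
  (forall xi : 'I_n -> H, 0 <= \sum_i \sum_j '[xi i, psi (X i j) (xi j)]) ->
  positive (amplification psi X).
Proof.
move=> h; apply/positive_op_matrixP => xi.
under eq_bigr do under eq_bigr do rewrite mxE.
exact: h.
Qed.

Lemma form_k_positive k (a : matalg A k)
    (psi : {linear A -> bounded_operator H}) :
  k_positive k psi -> positive a ->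
  forall e : 'I_k -> H, 0 <= \sum_i \sum_j '[e i, psi (a i j) (e j)].
Proof.
move=> kp pa e; have : positive (amplification psi a) by apply: kp; exists a.
move=> /positive_op_matrixP/(_ e).
by under eq_bigr do under eq_bigr do rewrite mxE.
Qed.

Lemma form_row_k_positive k (w : 'I_k -> A) : k_positive k phi ->
  forall e : 'I_k -> H,
  0 <= \sum_i \sum_j '[e i, phi (amul (star (w i)) (w j)) (e j)].
Proof.
(* For [k = 0] there is no first row, but the form is an empty sum. *)
case: k w => [|k] w kp e; first by rewrite big_ord0.
(* [[w_i^* w_j]] is [b^* b] where [b] has first row [w] and zeros below. *)
pose b : matalg A k.+1 := \matrix_(i, j) (if i == ord0 then w j else 0).
have := @form_k_positive k.+1 (amul (star b) b) phi kp (ex_intro _ b erefl) e.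
congr (0 <= _); apply: eq_bigr => i _; apply: eq_bigr => j _.
rewrite mxE (bigD1 ord0)//= !mxE eqxx big1 ?addr0// => l /negPf l0.
by rewrite !mxE l0 amulr0.
Qed.

(** Coefficients move from the vectors to the algebra elements because the inner product in its
    first variable and the star are both conjugate-linear. [form_right_change] is the linear
    counterpart. *)
Lemma form_left_change n k (f : 'I_k -> H) (c : 'I_n -> 'I_k -> R[i])
    (v : 'I_n -> A) (y : A) z :
  \sum_i '[\sum_m c i m *: f m, phi (amul (star (v i)) y) z] =
  \sum_m '[f m, phi (amul (star (\sum_i c i m *: v i)) y) z].
Proof.
under eq_bigr do rewrite inner_suml.
rewrite exchange_big; apply: eq_bigr => m _ /=.
rewrite star_sum amul_suml linear_sum operator_sum inner_sumr.
apply: eq_bigr => i _.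
have -> : phi (amul (star (c i m *: v i)) y) =
    conjc (c i m) *: phi (amul (star (v i)) y).
  by rewrite starZ amulZl; exact: (linearZ_LR phi).
by rewrite operatorZ innerZl innerZr.
Qed.

Lemma form_right_change n k (f : 'I_k -> H) (c : 'I_n -> 'I_k -> R[i])
    (v : 'I_n -> A) (y : A) :
  \sum_j phi (amul y (v j)) (\sum_l c j l *: f l) =
  \sum_l phi (amul y (\sum_j c j l *: v j)) (f l).
Proof.
under eq_bigr do rewrite linear_sum.
rewrite exchange_big; apply: eq_bigr => l _ /=.
rewrite amul_sumr linear_sum operator_sum; apply: eq_bigr => j _.
have -> : phi (amul y (c j l *: v j)) = c j l *: phi (amul y (v j)).
  by rewrite amulZr; exact: (linearZ_LR phi).
by rewrite operatorZ; exact: (linearZ_LR (phi _)).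
Qed.

Lemma form_span_k_positive k n d (e : 'I_d -> H) (xi : 'I_n -> H)
    (a : matalg A n) :
  k_positive k phi -> (d <= k)%N -> (forall i, lin_span e (xi i)) ->
  positive a -> 0 <= \sum_i \sum_j '[xi i, phi (a i j) (xi j)].
Proof.
move=> kp dk exi [b ->].
(* The family is padded with zeros from [d] to [k] vectors, the number on which [k]-positivity
   acts. *)
pose f (m : 'I_k) := if insub (val m) is Some m' then e m' else 0.
have /choice[c cE] i : exists c : 'I_k -> R[i], \sum_m c m *: f m = xi i.
  suff [c _ <-] : lin_span f (xi i) by exists c.
  apply: sub_lin_span (exi i) => m.
  have <- : f (widen_ord dk m) = e m by rewrite /f /= valK.
  exact: lin_span_gen.
(* Splitting into rows after applying [phi] avoids the fact that a sum of
   positive elements of [M_k(A)] is again of the form [d^* d]. *)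
have -> : \sum_i \sum_j '[xi i, phi (amul (star b) b i j) (xi j)] =
    \sum_r \sum_i \sum_j '[xi i, phi (amul (star (b r i)) (b r j)) (xi j)].
  rewrite [RHS]exchange_big; apply: eq_bigr => i _.
  rewrite [RHS]exchange_big; apply: eq_bigr => j _ /=.
  rewrite mxE linear_sum operator_sum inner_sumr; apply: eq_bigr => r _.
  by rewrite mxE.
apply: sumr_ge0 => r _.
(* Expanding the vectors [xi i] along [f] turns the row [r] of [n] entries into [k] combinations of
   them. *)
have := form_row_k_positive (fun m => \sum_i c i m *: b r i) kp f.
congr (0 <= _); rewrite exchange_big /=.
under eq_bigr do rewrite -form_left_change.
rewrite exchange_big; apply: eq_bigr => i _ /=.
rewrite -inner_sumr -form_right_change cE inner_sumr.
by apply: eq_bigr => j _; rewrite cE.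
Qed.

End CompressionForms.

(** * Cyclic proof of the equivalence *)

Theorem theorem3p3 (R : realType) (A : cstarAlgType R) (H : hilbertType R)
    (k : nat) (phi : {linear A -> bounded_operator H}) :
  [<-> k_positive k phi;
       forall (n : nat) (xi : 'I_n -> H) (a : matalg A n),
         (exists2 d, (d <= k)%N & has_dim (lin_span xi) d) ->
         positive a ->
         0 <= \sum_(i < n) \sum_(j < n) '[xi i, phi (a i j) (xi j)];
       forall p : bounded_operator H, Proj k p ->
         completely_positive (compression p phi)].
Proof.
tfae.
- move=> kp n xi a [d dk [e _ exi]] pa.
  apply: (form_span_k_positive (e := e) kp dk _ pa) => i.
  by rewrite exi; exact: lin_span_gen.
- move=> h p Pp m _ [a pa <-]; apply: positive_amplification => xi.
  have := h m (fun i => p (xi i)) a (has_dim_range_Proj xi Pp) pa.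
  congr (0 <= _); apply: eq_bigr => i _; apply: eq_bigr => j _.
  (* Self-adjointness of [p] identifies the form of the compression at [xi] with the form of [phi]
     at the vectors [p (xi i)]. *)
  by case: Pp => sp _ _; rewrite -{1}sp starP.
- move=> h _ [a pa <-]; apply: positive_amplification => xi.
  (* Here [xi] consists of [k] vectors, so the projection on their span lies in [Proj k]; it fixes
     each of them, and the compression has the same form at [xi] as [phi]. *)
  have [d [f [dk fo fxi]]] := gram_schmidt xi.
  have Pp := proj_op_Proj fo dk.
  have pxi i : proj_op f (xi i) = xi i.
    by apply: (proj_op_id fo); rewrite fxi; exact: lin_span_gen.
  have := form_k_positive (h _ Pp k) pa xi.
  congr (0 <= _); apply: eq_bigr => i _; apply: eq_bigr => j _.
  case: Pp => sp _ _.
  have -> : compression (proj_op f) phi (a i j) (xi j) =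
    proj_op f (phi (a i j) (proj_op f (xi j))) by [].
  by rewrite pxi -starP sp pxi.
Qed.
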